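(* Let $\psi:\Sigma\to\mathbb{L}^4$ be a marginally trapped surface. Then its hyperbolic Gauss map $G:\Sigma\to\mathbb{C}\cup\{\infty\}$ is conformal.
   Context: $\mathbb{L}^4$ is $\mathbb{R}^4$ with the metric $\langle,\rangle=-dx_0^2+dx_1^2+dx_2^2+dx_3^2$, identified with the space of $2\times2$ Hermitian matrices by $(x_0,x_1,x_2,x_3)\leftrightarrow\begin{pmatrix}x_0+x_3&x_1+ix_2\\ x_1-ix_2&x_0-x_3\end{pmatrix}$. The positive light cone is $\mathbb{N}^3=\{x:\langle x,x\rangle=0,\ x_0>0\}=\{ww^*: w^t=(w_1,w_2)\in\mathbb{C}^2\setminus\{(0,0)\}\}$, where $w^*=\bar w^t$. The quotient $\mathbb{S}^2_\infty=\mathbb{N}^3/\mathbb{R}^+$ inherits a conformal structure from the degenerate metric on $\mathbb{N}^3$ and is identified with $\mathbb{C}\mathbf{P}^1\equiv\mathbb{C}\cup\{\infty\}$ via $ww^*\mapsto[(w_1,w_2)]$. A spacelike surface $\psi:\Sigma\to\mathbb{L}^4$ is an immersion of a connected orientable surface whose induced metric is Riemannian; $\Sigma$ is regarded as a Riemann surface with the induced conformal structure. Let $\{\eta,\tilde\eta\}$ be a (local) oriented orthonormal frame of the normal bundle, with $\eta$ spacelike and $\tilde\eta$ timelike with values in $\mathbb{H}^3=\{x:\langle x,x\rangle=-1,\ x_0>0\}$. The hyperbolic Gauss map is $G=[\eta+\tilde\eta]:\Sigma\to\mathbb{S}^2_\infty\equiv\mathbb{C}\cup\{\infty\}$, which does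 not depend on the choice of such frame of the oriented normal bundle. A surface is marginally trapped if its mean curvature vector $\mathbf{H}$ satisfies $\langle\mathbf{H},\mathbf{H}\rangle=0$ (this includes $\mathbf H\equiv0$). Standing convention: for a marginally trapped surface the normal bundle is oriented so that $\mathbf{H}$ is everywhere a real multiple of $\eta+\tilde\eta$ (equivalently $\langle\psi_{z\bar z},\eta\rangle=-\langle\psi_{z\bar z},\tilde\eta\rangle$ for conformal coordinates $z$). Conformality is meant in the weak sense (points where $dG=0$, and constant $G$, are allowed), i.e. $\langle(\eta+\tilde\eta)_z,(\eta+\tilde\eta)_z\rangle=0$ for every local conformal coordinate $z$. *)

(* Defs.v *)
From HB Require Import structures.
From mathcomp Require Import all_boot all_order all_algebra.
From mathcomp Require Import all_classical all_reals all_analysis.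
From mathcomp Require Import complex.

Set Implicit Arguments.
Unset Strict Implicit.
Unset Printing Implicit Defensive.
Import Order.TTheory GRing.Theory Num.Theory.
Import numFieldNormedType.Exports.
Local Open Scope classical_set_scope.
Local Open Scope ring_scope.
Local Open Scope complex_scope.

Section Calculus.
Context {R : realType} {m n : nat}.

(* f is of class C^k on D; only meant for open D, where the directional
   derivatives at points of D depend on f restricted to D only. *)
Fixpoint class_C (k : nat) (D : set 'rV[R]_m.+1)
    (f : 'rV[R]_m.+1 -> 'rV[R]_n.+1) : Prop :=
  match k with
  | 0 => forall q, D q -> {for q, continuous f}
  | k'.+1 => (forall q, D q -> differentiable f q) /\
             (forall v, class_C k' D (fun q => 'D_v f q))
  end.

Definition smooth (D : set 'rV[R]_m.+1) (f : 'rV[R]_m.+1 -> 'rV[R]_n.+1) :=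
  forall k, class_C k D f.

Definition partial (i : 'I_m.+1) (f : 'rV[R]_m.+1 -> 'rV[R]_n.+1)
    (q : 'rV[R]_m.+1) : 'rV[R]_n.+1 :=
  'D_(delta_mx 0 i) f q.

End Calculus.

(* f_z = (f_u - i f_v) / 2, for z = u + i v. *)
Definition wirtinger (R : realType) (n : nat) (f : 'rV[R]_2 -> 'rV[R]_n.+1)
    (q : 'rV[R]_2) : 'rV[R[i]]_n.+1 :=
  2^-1 *: (map_mx (real_complex R) (partial 0 f q)
           - (0 +i* 1) *: map_mx (real_complex R) (partial 1 f q)).

(* The Lorentzian product of L^4 = 'rV[R]_4, and, over R[i], its complex
   bilinear extension. *)
Definition mink (K : comNzRingType) (x y : 'rV[K]_4) : K :=
  - (x 0 0 * y 0 0) + x 0 1 * y 0 1 + x 0 2 * y 0 2 + x 0 3 * y 0 3.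

Section LightCone.
Context {R : realType}.

Definition hermitian_of (x : 'rV[R]_4) : 'M[R[i]]_2 :=
  \matrix_(k < 2, l < 2)
    if k == 0 then if l == 0 then (x 0 0 + x 0 3)%:C else x 0 1 +i* x 0 2
    else if l == 0 then x 0 1 -i* x 0 2 else (x 0 0 - x 0 3)%:C.

Definition conj_tr (w : 'cV[R[i]]_2) : 'rV[R[i]]_2 :=
  \row_j (w j 0)^*%C.

(* CP^1 is identified with R[i] + {infinity} = option (R[i]) by
   [(w1, w2)] |-> w1 / w2, the point [(1, 0)] being infinity = None. *)
Definition CP1_class (w : 'cV[R[i]]_2) : option R[i] :=
  if w 1 0 == 0 then None else Some (w 0 0 / w 1 0).

(* [null_class x g]: x belongs to the positive light cone N^3, and g is its
   class [x] in N^3 / R^+ = C + {infinity}. *)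
Definition null_class (x : 'rV[R]_4) (g : option R[i]) : Prop :=
  exists w : 'cV[R[i]]_2,
    [/\ w != 0, hermitian_of x = w *m conj_tr w & g = CP1_class w].

End LightCone.

Record chart (R : realType) (T : topologicalType) := Chart {
  dom : set T;
  coord : T -> 'rV[R]_2;
  param : 'rV[R]_2 -> T;
  dom_open : open dom;
  cod_open : open (coord @` dom);
  paramK : forall p, dom p -> param (coord p) = p;
  coord_continuous : {within dom, continuous coord};
  param_continuous : {within coord @` dom, continuous param}
}.

Definition cod (R : realType) (T : topologicalType) (c : chart R T)
    : set 'rV[R]_2 :=
  coord c @` dom c.

(* The change of coordinates from c to d is smooth and preserves orientation. *)
Definition oriented_change (R : realType) (T : topologicalType)
    (c d : chart R T) : Prop :=
  let D := coord c @` (dom c `&` dom d) in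
  let f := coord d \o param c in
  smooth D f /\ (forall q, D q -> 0 < \det ('J f q)).

(* Connected oriented smooth surfaces; [atlas] is the maximal oriented atlas,
   i.e. the set of all oriented local coordinate systems. *)
Record surface (R : realType) := Surface {
  points :> topologicalType;
  atlas : set (chart R points);
  points_hausdorff : hausdorff_space points;
  points_second_countable : @second_countable points;
  points_connected : connected [set: points];
  atlas_cover : forall p, exists2 c, atlas c & dom c p;
  atlas_change : forall c d, atlas c -> atlas d -> oriented_change c d;
  atlas_maximal : forall c,
    (forall d, atlas d -> oriented_change c d /\ oriented_change d c) ->
    atlas c
}.

(* Local geometry of a parametrized spacelike surface X in L^4. *)
Section LocalGeometry.
Context {R : realType}.
Variables (X : 'rV[R]_2 -> 'rV[R]_4) (q : 'rV[R]_2).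

Definition first_form : 'M[R]_2 :=
  \matrix_(i, j) mink (partial i X q) (partial j X q).

Definition normal_part (w : 'rV[R]_4) : 'rV[R]_4 :=
  w - \sum_(i < 2) \sum_(j < 2)
        (invmx first_form i j * mink w (partial i X q)) *: partial j X q.

Definition second_form (i j : 'I_2) : 'rV[R]_4 :=
  normal_part (partial i (partial j X) q).

Definition mean_curvature : 'rV[R]_4 :=
  2^-1 *: \sum_(i < 2) \sum_(j < 2) invmx first_form i j *: second_form i j.

(* (a, b) = (eta, eta~) is an orthonormal basis of the normal plane, with a
   spacelike and b timelike in H^3, positive for the orientation o of the
   normal plane.  As the surface is oriented and connected, its normal bundle
   has exactly two orientations: (a, b) is positive for one of them (o = false)
   when (X_u, X_v, a, b) is a positive basis of R^4, and for the other one
   (o = true) when (X_u, X_v, a, b) is a negative basis. *)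
Definition normal_frame (o : bool) (a b : 'rV[R]_4) : Prop :=
  [/\ forall i, mink a (partial i X q) = 0,
      forall i, mink b (partial i X q) = 0,
      [/\ mink a a = 1, mink a b = 0, mink b b = -1 & 0 < b 0 0] &
      0 < (-1) ^+ o *
          \det (\matrix_(k < 4)
                  nth 0 [:: partial 0 X q; partial 1 X q; a; b] k)].

End LocalGeometry.

Section Surfaces.
Context {R : realType} (S : surface R).
Implicit Types (psi eta etat N : S -> 'rV[R]_4) (c : chart R S) (p : S).
Implicit Types (o : bool) (G : S -> option R[i]) (W : set S).

Definition smooth_on W (f : S -> 'rV[R]_4) : Prop :=
  forall c, atlas c -> smooth (coord c @` (dom c `&` W)) (f \o param c).

Definition immersion psi : Prop :=
  smooth_on setT psi /\
  forall c q v, atlas c -> cod c q -> 'D_v (psi \o param c) q = 0 -> v = 0.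

Definition spacelike_surface psi : Prop :=
  immersion psi /\
  forall c q v, atlas c -> cod c q -> v != 0 ->
    0 < mink ('D_v (psi \o param c) q) ('D_v (psi \o param c) q).

Definition conformal_chart psi c : Prop :=
  atlas c /\
  forall q, cod c q ->
    exists2 l : R, 0 < l & first_form (psi \o param c) q = l%:M.

Definition mean_curvature_at psi c p : 'rV[R]_4 :=
  mean_curvature (psi \o param c) (coord c p).

Definition normal_frame_at psi o c p (a b : 'rV[R]_4) : Prop :=
  normal_frame (psi \o param c) (coord c p) o a b.

Definition local_normal_frame psi o W eta etat : Prop :=
  [/\ open W, smooth_on W eta, smooth_on W etat &
      forall c p, atlas c -> dom c p -> W p ->
        normal_frame_at psi o c p (eta p) (etat p)].

Definition marginally_trapped psi : Prop :=
  forall c p, atlas c -> dom c p ->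
    mink (mean_curvature_at psi c p) (mean_curvature_at psi c p) = 0.

(* The convention singling out the orientation o of the normal bundle of a
   marginally trapped surface. *)
Definition adapted_orientation psi o : Prop :=
  forall c p a b, atlas c -> dom c p -> normal_frame_at psi o c p a b ->
    exists r : R, mean_curvature_at psi c p = r *: (a + b).

(* G = [eta + eta~]. *)
Definition hyperbolic_gauss_map psi o G : Prop :=
  forall c p a b, atlas c -> dom c p -> normal_frame_at psi o c p a b ->
    null_class (a + b) (G p).

(* Weak conformality into N^3 / R^+, for the conformal structure induced by the
   degenerate metric of N^3: <N_z, N_z> = 0 for every conformal coordinate z
   and every local lift N of G to N^3.  By [gauss_map_conformalP] below, this
   contains the condition for the lifts eta + eta~ of the Gauss map; any other
   lift is l * (eta + eta~), with l > 0, and <N_z, N_z> is then multiplied by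
   l ^+ 2. *)
Definition conformal psi G : Prop :=
  forall c W N, conformal_chart psi c -> open W ->
    (forall p, W p -> null_class (N p) (G p)) ->
    (forall p, dom c p -> W p -> differentiable (N \o param c) (coord c p)) ->
    forall p, dom c p -> W p ->
      mink (wirtinger (N \o param c) (coord c p))
           (wirtinger (N \o param c) (coord c p)) = 0.

Lemma gauss_map_conformalP psi o G :
  hyperbolic_gauss_map psi o G -> conformal psi G ->
  forall c W eta etat p, conformal_chart psi c ->
    local_normal_frame psi o W eta etat -> dom c p -> W p ->
    let f := (fun p => eta p + etat p) \o param c in
    mink (wirtinger f (coord c p)) (wirtinger f (coord c p)) = 0.
Proof.
move=> GG Gconf c W eta etat p cc [Wo se st fr] cp Wp /=.
apply: (Gconf c W (fun p => eta p + etat p) cc Wo _ _ p cp Wp) => p'.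
  move=> Wp'; have [d da dp] := atlas_cover p'.
  exact: GG da dp (fr _ _ da dp Wp').
move=> cp' Wp'.
have Dp' : (coord c @` (dom c `&` W)) (coord c p') by exists p'.
have [de _] := se c cc.1 1%N; have [dt _] := st c cc.1 1%N.
exact: (differentiableD (de _ Dp') (dt _ Dp')).
Qed.

End Surfaces.

(* Main.v *)
Require Import Defs.
From mathcomp Require Import all_boot all_order all_algebra.
From mathcomp Require Import all_classical all_reals all_analysis.
From mathcomp Require Import complex.
From mathcomp Require Import ring lra.

(* In a conformal coordinate z = u + i v, with X the parametrized surface, let N
   be a lift of G.  Then N is a nonzero multiple of eta + eta~, so N is null,
   normal and orthogonal to the mean curvature vector, whence
   <N, X_uu + X_vv> = 0.  Differentiating <N, X_u> = <N, X_v> = 0 turns the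
   tangential components of N_u and N_v into -(A, B) and -(B, C), where
   A = <N, X_uu>, B = <N, X_uv> and C = <N, X_vv> = - A.  Differentiating
   <N, N> = 0, the normal components of N_u and N_v are multiples of the null
   vector N and do not contribute to the products.  Hence
   |N_u|^2 = (A^2 + B^2) / l = (B^2 + C^2) / l = |N_v|^2 and
   <N_u, N_v> = B (A + C) / l = 0. *)

Set Implicit Arguments.
Unset Strict Implicit.
Unset Printing Implicit Defensive.
Import Order.TTheory GRing.Theory Num.Theory.
Import numFieldNormedType.Exports.
Local Open Scope classical_set_scope.
Local Open Scope ring_scope.
Local Open Scope complex_scope.

(** * Algebra of the Lorentzian product *)

Lemma big_ord4 (V : nmodType) (F : 'I_4 -> V) :
  \sum_(i < 4) F i = F 0 + F 1 + F 2 + F 3.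
Proof.
rewrite !big_ord_recr big_ord0 /= add0r.
by congr (_ + _ + _ + _); congr F; apply/val_inj.
Qed.

Section Mink.
Context {K : comNzRingType}.
Implicit Types x y z : 'rV[K]_4.

Lemma minkC x y : mink x y = mink y x.
Proof. by rewrite /mink; ring. Qed.

Lemma minkDl x y z : mink (x + y) z = mink x z + mink y z.
Proof. by rewrite /mink !mxE; ring. Qed.

Lemma minkZl k x z : mink (k *: x) z = k * mink x z.
Proof. by rewrite /mink !mxE; ring. Qed.

Lemma minkDr x y z : mink x (y + z) = mink x y + mink x z.
Proof. by rewrite minkC minkDl !(minkC _ x). Qed.

Lemma minkZr k x z : mink x (k *: z) = k * mink x z.
Proof. by rewrite minkC minkZl minkC. Qed.

Lemma minkNl x z : mink (- x) z = - mink x z.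
Proof. by rewrite -scaleN1r minkZl mulN1r. Qed.

Lemma minkBl x y z : mink (x - y) z = mink x z - mink y z.
Proof. by rewrite minkDl minkNl. Qed.

Lemma mink_suml (I : finType) (F : I -> 'rV[K]_4) z :
  mink (\sum_i F i) z = \sum_i mink (F i) z.
Proof.
have mink0l : mink 0 z = 0 by rewrite -(scale0r z) minkZl mul0r.
by apply: (big_rec2 (fun x s => mink x z = s)) => // i s x _ <-; rewrite minkDl.
Qed.

(** Matrix form of the product: Gram matrices of families of rows become products with the diagonal
    metric matrix. *)
Lemma mink_row m n (A : 'M[K]_(m, 4)) (B : 'M[K]_(n, 4)) i j :
  mink (row i A) (row j B) =
  (A *m diag_mx (\row_k (-1) ^+ (k == 0 :> 'I_4)) *m B^T) i j.
Proof.
rewrite mxE big_ord4 /mink !mul_mx_diag !mxE /=.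
by ring.
Qed.

Lemma mink_isotropic c j x y : j * j = -1 ->
  mink x x = mink y y -> mink x y = 0 ->
  mink (c *: (x - j *: y)) (c *: (x - j *: y)) = 0.
Proof.
move=> jj xx xy.
have -> : mink (c *: (x - j *: y)) (c *: (x - j *: y)) =
    c * c * (mink x x + j * j * mink y y - 2 * j * mink x y).
  by rewrite /mink !mxE; ring.
by rewrite jj xx xy; ring.
Qed.

End Mink.

(** Up to the factor 1/4, <f_z, f_z> is |f_u|^2 - |f_v|^2 - 2i <f_u, f_v>, so the complex condition
    reduces to two real ones. *)
Lemma mink_wirtinger (R : realType) (f : 'rV[R]_2 -> 'rV[R]_4) q :
  mink (partial 0 f q) (partial 0 f q) = mink (partial 1 f q) (partial 1 f q) ->
  mink (partial 0 f q) (partial 1 f q) = 0 ->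
  mink (wirtinger f q) (wirtinger f q) = 0.
Proof.
rewrite /wirtinger.
move: (partial 0 f q) (partial 1 f q) => a b e1 e2.
have aux (x y : 'rV[R]_4) : mink (map_mx (real_complex R) x)
    (map_mx (real_complex R) y) = (mink x y)%:C.
  by rewrite /mink !mxE -!rmorphM -!rmorphN -!rmorphD.
have ii : (0 +i* 1) * (0 +i* 1) = -1 :> R[i] by rewrite -expr2 sqr_i.
by apply: (mink_isotropic _ ii); rewrite !aux ?e1 ?e2.
Qed.

(** Taking normal parts changes a vector by a tangent one, invisible to a normal [N], and the
    inverse metric is [l^-1] times the identity, so the trace becomes a Laplacian. *)
Lemma mean_curvature_conformal (R : realType) (X : 'rV[R]_2 -> 'rV[R]_4) q l N :
  first_form X q = l%:M -> l != 0 ->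
  (forall i, mink (partial i X q) N = 0) ->
  mink (mean_curvature X q) N =
  (2 * l)^-1 * (mink (partial 0 (partial 0 X) q) N
                + mink (partial 1 (partial 1 X) q) N).
Proof.
move=> e l0 XN.
have np w : mink (normal_part X q w) N = mink w N.
  rewrite /normal_part minkBl mink_suml big1 ?subr0// => i _.
  by rewrite mink_suml big1// => j _; rewrite minkZl XN mulr0.
have trace (h : 'I_2 -> 'I_2 -> R) :
    2^-1 * (\sum_i \sum_j ((l^-1)%:M : 'M[R]_2) i j * h i j) =
    (2 * l)^-1 * (h 0 0 + h 1 1).
  rewrite !big_ord_recl !big_ord0 !mxE /=.
  have -> : lift ord0 ord0 = 1 :> 'I_2 by apply/val_inj.
  by rewrite mulr1n mulr0n; field; exact: l0.
rewrite /mean_curvature minkZl mink_suml e invmx_scalar.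
rewrite -(trace (fun i j => mink (partial i (partial j X) q) N)).
congr (_ * _); apply: eq_bigr => i _; rewrite mink_suml; apply: eq_bigr => j _.
by rewrite minkZl np.
Qed.

(** * Orthogonal frames adapted to a spacelike plane: expansion and existence *)

Section Frame.
Context {K : fieldType}.
Variables (u v a b : 'rV[K]_4) (l : K).
Hypothesis l0 : l != 0.
Hypotheses (uu : mink u u = l) (uv : mink u v = 0) (vv : mink v v = l).
Hypotheses (au : mink a u = 0) (av : mink a v = 0) (bu : mink b u = 0)
  (bv : mink b v = 0) (aa : mink a a = 1) (ab : mink a b = 0)
  (bb : mink b b = -1).

Let E : 'M[K]_4 := \matrix_(k < 4) nth 0 [:: u; v; a; b] k.
Let J : 'M[K]_4 := diag_mx (\row_i (-1) ^+ (i == 0 :> 'I_4)).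
Let D : 'rV[K]_4 := \row_k nth 0 [:: l^-1; l^-1; 1; -1] k.

(** The Gram matrix [E *m J *m E^T] is diagonal with entries l, l, 1, -1, and [D] lists their
    inverses. *)
Let frame_inv : E *m (J *m E^T *m diag_mx D) = 1%:M.
Proof.
apply/matrixP => i j; rewrite mulmxA mul_mx_diag mxE mulmxA.
rewrite -mink_row !rowK !mxE.
case: i => [[|[|[|[|//]]]] i4]; case: j => [[|[|[|[|//]]]] j4] /=;
  rewrite ?(uu, uv, vv, au, av, bu, bv, aa, ab, bb)
    ?mulfV // ?mulrNN ?mulr1 ?mul0r //.
all: rewrite minkC ?(uv, au, av, bu, bv, ab) ?mul0r//.
Qed.

Lemma frame_det_neq0 : \det E != 0.
Proof.
have := frame_inv => /(congr1 determinant); rewrite det1 det_mulmx => e.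
apply/eqP => d0; move: e; rewrite d0 mul0r => /esym/eqP.
by rewrite oner_eq0.
Qed.

Lemma frame_parseval y z : mink y z =
  l^-1 * (mink y u * mink z u + mink y v * mink z v)
  + mink y a * mink z a - mink y b * mink z b.
Proof.
rewrite -[y in LHS](row_id 0) -[z in LHS](row_id 0) mink_row -/J.
(* A right inverse of a square matrix is also a left inverse; this resolution of the identity is
   inserted after [y]. *)
rewrite -[y in LHS]mulmx1 -(mulmx1C frame_inv).
have -> : y *m (J *m E^T *m diag_mx D *m E) *m J *m z^T =
    (y *m J *m E^T) *m diag_mx D *m (z *m J *m E^T)^T.
  by rewrite !trmx_mul trmxK tr_diag_mx !mulmxA.
rewrite mxE big_ord4 mul_mx_diag.
have c w k : (w *m J *m E^T) 0 k = mink w (row k E).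
  by rewrite -mink_row row_id.
rewrite ![(\matrix_(i, j) (_ * _)) _ _]mxE ![_^T _ 0]mxE !c !rowK !mxE /=.
by ring.
Qed.

(** Meant for y = N_u and z = N_v. Orthogonality to [a + b] makes the [a] and [b] coefficients
    opposite, so their contributions to the expansion cancel and only the tangential ones remain. *)
Lemma frame_isotropic k y z yyu yyv zzu zzv :
  k != 0 -> mink y (k *: (a + b)) = 0 -> mink z (k *: (a + b)) = 0 ->
  mink y u = - yyu -> mink y v = - yyv ->
  mink z u = - zzu -> mink z v = - zzv -> yyu + zzv = 0 -> yyv = zzu ->
  mink y y = mink z z /\ mink y z = 0.
Proof.
move=> k0 yn zn yu yv zu zv /eqP; rewrite addr_eq0 => /eqP tr0 sym.
have na w : mink w (k *: (a + b)) = 0 -> mink w a = - mink w b.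
  rewrite minkZr minkDr => /eqP; rewrite mulf_eq0 (negPf k0) addr_eq0 => /eqP//.
split; last by rewrite frame_parseval !na// yu yv zu zv tr0 sym; ring.
rewrite [LHS]frame_parseval [RHS]frame_parseval !na// yu yv zu zv tr0 sym.
by ring.
Qed.

End Frame.

(* The Lorentzian dual of the linear form w |-> det (x, y, z, w),
   up to sign. *)
Definition cross (K : comNzRingType) (x y z : 'rV[K]_4) : 'rV[K]_4 :=
  let m i j k :=
    x 0 i * (y 0 j * z 0 k - y 0 k * z 0 j)
    - x 0 j * (y 0 i * z 0 k - y 0 k * z 0 i)
    + x 0 k * (y 0 i * z 0 j - y 0 j * z 0 i) in
  \row_k nth 0 [:: m 1 2 3; m 0 2 3; - m 0 1 3; m 0 1 2] k.

Lemma mink_cross (K : comNzRingType) (x y z : 'rV[K]_4) :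
  [/\ mink (cross x y z) x = 0, mink (cross x y z) y = 0
    & mink (cross x y z) z = 0].
Proof. by split; rewrite /mink /cross !mxE /=; ring. Qed.

(** The square of the cross product is minus the Gram determinant of its arguments, which is
    diagonal here. *)
Lemma mink_cross_cross (K : comNzRingType) (x y z : 'rV[K]_4) :
  mink y x = 0 -> mink z x = 0 -> mink z y = 0 ->
  mink (cross x y z) (cross x y z) = - (mink x x * mink y y * mink z z).
Proof.
move=> yx zx zy.
have -> : mink (cross x y z) (cross x y z) =
  - (mink x x * mink y y * mink z z + 2 * (mink y x * mink z y * mink z x)
     - mink x x * mink z y ^+ 2 - mink y y * mink z x ^+ 2
     - mink z z * mink y x ^+ 2).
  by rewrite /mink /cross !mxE /=; ring.
by rewrite yx zx zy; ring.
Qed.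

Lemma det_rowN (K : comNzRingType) (x y z w : 'rV[K]_4) :
  \det (\matrix_(k < 4) nth 0 [:: x; y; - z; w] k) =
  - \det (\matrix_(k < 4) nth 0 [:: x; y; z; w] k).
Proof.
have -> : (\matrix_(k < 4) nth 0 [:: x; y; - z; w] k) =
    diag_mx (\row_i (-1) ^+ (i == 2 :> 'I_4)) *m
    \matrix_(k < 4) nth 0 [:: x; y; z; w] k.
  apply/matrixP => i j; rewrite mul_diag_mx !mxE.
  by case: i => [[|[|[|[|//]]]] i4] /=; rewrite ?mul1r // !mxE ?expr1 ?mulN1r.
by rewrite det_mulmx det_diag !big_ord_recr big_ord0 !mxE /=; ring.
Qed.

Lemma forall_I2 (P : 'I_2 -> Prop) : P 0 -> P 1 -> forall i, P i.
Proof.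
move=> P0 P1; case=> [[|[|//]] i2].
  by have -> : Ordinal i2 = 0 by apply/val_inj.
by have -> : Ordinal i2 = 1 by apply/val_inj.
Qed.

(** The Gauss map and the orientation convention are quantified over all frames, so a frame must be
    exhibited before they give any information. *)
Lemma normal_frame_exists (R : realType) (X : 'rV[R]_2 -> 'rV[R]_4) q o l :
  0 < l -> first_form X q = l%:M -> exists a b, normal_frame X q o a b.
Proof.
move=> l0 /matrixP e.
have := (e 0 0, e 0 1, e 1 1); rewrite !mxE /= mulr1n mulr0n => -[[]].
rewrite /normal_frame.
suff F (u v : 'rV[R]_4) : mink u u = l -> mink u v = 0 -> mink v v = l ->
  exists a b : 'rV[R]_4, [/\ mink a u = 0 /\ mink a v = 0,
    mink b u = 0 /\ mink b v = 0,
    [/\ mink a a = 1, mink a b = 0, mink b b = -1 & 0 < b 0 0] &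
    0 < (-1) ^+ o * \det (\matrix_(k < 4) nth 0 [:: u; v; a; b] k)].
  move=> uu uv vv; have [a [b [ha hb h1 h2]]] := F _ _ uu uv vv.
  exists a, b; split; [exact: forall_I2 ha.1 ha.2
    | exact: forall_I2 hb.1 hb.2 | exact: h1 | exact: h2].
move=> {e} uu uv vv.
(* [s] is both the time coordinate of [t] below and [- mink t t]; its positivity makes [t] timelike
   and future-directed. *)
pose s := 1 + (u 0 0 ^+ 2 + v 0 0 ^+ 2) / l.
have s0 : 0 < s.
  by rewrite ltr_pwDl// divr_ge0 ?(ltW l0)// addr_ge0// sqr_ge0.
(* t is the normal component of the time vector; a will be a multiple of the
   cross product of u, v and t. *)
pose t := delta_mx 0 0 + (u 0 0 / l) *: u + (v 0 0 / l) *: v.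
have ed (x : 'rV[R]_4) : mink (delta_mx 0 0) x = - x 0 0.
  by rewrite /mink !mxE /=; ring.
have tu : mink t u = 0.
  rewrite /t !minkDl !minkZl ed uu (minkC v) uv; field; exact: lt0r_neq0.
have tv : mink t v = 0.
  rewrite /t !minkDl !minkZl ed uv vv; field; exact: lt0r_neq0.
have t00 : t 0 0 = s.
  rewrite /t /s !mxE /=; field; exact: lt0r_neq0.
have tt : mink t t = - s.
  rewrite {2}/t !minkDr !minkZr tu tv !mulr0 !addr0 minkC ed t00 //.
pose r := Num.sqrt s.
have r0 : 0 < r by rewrite sqrtr_gt0.
have rr : r * r = s by rewrite -expr2 sqr_sqrtr ?ltW.
pose b := r^-1 *: t.
have bu : mink b u = 0 by rewrite minkZl tu mulr0.
have bv : mink b v = 0 by rewrite minkZl tv mulr0.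
have bb : mink b b = -1.
  by rewrite minkZl minkZr tt -rr; field; exact: lt0r_neq0.
have b0 : 0 < b 0 0 by rewrite mxE t00 mulr_gt0 ?invr_gt0.
(* The cross product has square l * l, since [b] has square -1. *)
pose a := l^-1 *: cross u v b.
have [cu cv cb] := mink_cross u v b.
have au : mink a u = 0 by rewrite minkZl cu mulr0.
have av : mink a v = 0 by rewrite minkZl cv mulr0.
have ab : mink a b = 0 by rewrite minkZl cb mulr0.
have aa : mink a a = 1.
  rewrite minkZl minkZr mink_cross_cross ?bu ?bv ?(minkC v)// uu vv bb.
  by field; exact: lt0r_neq0.
have := frame_det_neq0 (lt0r_neq0 l0) uu uv vv au av bu bv aa ab bb.
rewrite neq_lt => /orP dab.
(* The determinant is nonzero, so exactly one of [a] and [- a] gives the orientation [o]. *)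
have [dgt|dlt] :
  0 < (-1) ^+ o * \det (\matrix_(k < 4) nth 0 [:: u; v; a; b] k) \/
  0 < (-1) ^+ o * \det (\matrix_(k < 4) nth 0 [:: u; v; - a; b] k).
  rewrite det_rowN; case: (o) dab; rewrite ?expr1 ?expr0 ?mulN1r ?mul1r ?opprK
    ?oppr_gt0; tauto.
- by exists a, b.
- exists (- a), b; split => //; last split => //;
    rewrite ?minkNl ?au ?av ?ab ?oppr0//.
  by rewrite (minkC a) minkNl aa opprK.
Qed.

(** * Lifts of a point of the light cone quotient *)

(** Homogeneous coordinates of one point of CP^1 satisfy w' = c w, and w w^* is then multiplied by
    the real number |c|^2. *)
Lemma null_class_colinear (R : realType) (x y : 'rV[R]_4) g :
  null_class x g -> null_class y g -> exists2 k, k != 0 & y = k *: x.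
Proof.
move=> [w [w0 hx ->]] [w' [w'0 hy]] gg.
have colin (z : 'cV[R[i]]_2) c :
    z 0 0 = c * w 0 0 -> z 1 0 = c * w 1 0 -> z = c *: w.
  move=> z0 z1; apply/colP => i; rewrite mxE.
  by move: i; apply: forall_I2.
(* At infinity both second coordinates vanish and [c] is the ratio of the first ones; elsewhere it
   is the ratio of the second ones. *)
have [c wc] : exists c, w' = c *: w.
  move: gg; rewrite /CP1_class; case: ifPn => [/eqP w10|w10];
    case: ifPn => [/eqP w'10|w'10]//.
    exists (w' 0 0 / w 0 0); apply: (colin w'); last by rewrite w10 w'10 mulr0.
    rewrite divfK//; apply: contra w0 => /eqP w00.
    by rewrite (colin w 0) ?scale0r// ?w00 ?w10 mulr0.
  move=> [e]; exists (w' 1 0 / w 1 0); apply: (colin w'); last by rewrite divfK.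
  by rewrite mulrAC -mulrA e mulrC divfK.
have c0 : c != 0 by apply: contra w'0 => /eqP c0; rewrite wc c0 scale0r.
have [k kc] : exists k : R, c * c^*%C = k%:C.
  by case: (c) => p r; exists (p ^+ 2 + r ^+ 2); simpc; congr (_ +i* _); ring.
have k0 : k != 0.
  apply: contra c0 => /eqP k0; move/eqP: kc.
  by rewrite k0 mulf_eq0 conjc_eq0 orbb.
exists k => //.
have {hy} : hermitian_of y = k%:C *: hermitian_of x.
  rewrite hx hy wc -kc -scalemxAl -scalerA; congr (_ *: _).
  rewrite scalemxAr; congr (_ *m _); apply/rowP => j.
  by rewrite !mxE rmorphM.
(* The diagonal entries give x0 + x3 and x0 - x3, the off-diagonal one gives x1 and x2. *)
move=> /matrixP h; have := (h 0 0, h 0 1, h 1 1); rewrite !mxE /=.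
simpc => -[[[h00] [h1 h2]] [h3]].
apply/rowP => j; rewrite !mxE.
case: j => [[|[|[|[|//]]]] j4].
- by have -> : Ordinal j4 = 0; [apply/val_inj | lra].
- by have -> : Ordinal j4 = 1; [apply/val_inj | ].
- by have -> : Ordinal j4 = 2; [apply/val_inj | ].
- by have -> : Ordinal j4 = 3; [apply/val_inj | lra].
Qed.

(** * Symmetry of second derivatives *)

Section Schwarz.
Context {R : realType} {V : normedModType R}.
Implicit Types (f : V -> R) (q u v p : V).

Lemma is_derive_line f u p (s df : R) : is_derive (s *: u + p) u f df ->
  is_derive s 1 (fun t : R => f (t *: u + p)) df.
Proof.
have E : (fun h : R => h^-1 *:
      (((fun t : R => f (t *: u + p)) \o shift s) (h *: 1) - f (s *: u + p))) =
    (fun h : R => h^-1 *: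
      ((f \o shift (s *: u + p)) (h *: u) - f (s *: u + p))).
  apply/funext => h /=; congr (_ *: (f _ - _)).
  by rewrite scaler1 scalerDl addrA.
by move=> [fu fE]; split; rewrite /derivable /derive /= E.
Qed.

(* Mean value theorem in the direction u for f (_ + t v) - f, whose derivative
   is then expanded by the differentiability of g at q. *)
Lemma second_difference f g q u v :
  (\forall x \near q, is_derive x u f (g x)) -> differentiable g q ->
  forall e, 0 < e -> \forall t \near (0 : R)^'+,
    `|f (t *: u + (t *: v + q)) - f (t *: u + q) - (f (t *: v + q) - f q)
      - t ^+ 2 * 'D_v g q| <= e * t ^+ 2.
Proof.
move=> fu gd e e0.
have [gc /eqaddoP] := (diff_locallyP q g).1 gd.
(* With 0 <= c <= t, the increments c u + t v and c u have norms of sum at most t (2|u| + |v|),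
   hence at most t M; the added 1 keeps [M] positive. *)
pose M := 2 * `|u| + `|v| + 1.
have M0 : 0 < M by rewrite ltr_pwDr// addr_ge0// mulr_ge0.
move=> /(_ (e / M) (divr_gt0 e0 M0)) go.
have {}go : \forall h \near (0 : V),
    `|g (h + q) - g q - 'd g q h| <= e / M * `|h|.
  by near=> h; rewrite -addrA -opprD; near: h; exact: go.
have {}fu : \forall h \near (0 : V), is_derive (h + q) u f (g (h + q)).
  by move: fu; rewrite (near_shift 0) /= subr0.
have [r /= r0 hr] := nbhs_norm0P.1 (filterI go fu).
near=> t.
have t0 : 0 < t by near: t; exact: nbhs_right_gt.
have tr : t < r / M by near: t; apply: nbhs_right_lt; exact: divr_gt0.
have tM : t * M < r by rewrite -ltr_pdivlMr.
have u0 : 0 <= `|u| := normr_ge0 u.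
have v0 : 0 <= `|v| := normr_ge0 v.
have su s : 0 <= s <= t -> `|s *: u| <= t * `|u|.
  by move=> /andP[s0 st]; rewrite normrZ ger0_norm// ler_wpM2r.
have tv : `|t *: v| = t * `|v| by rewrite normrZ gtr0_norm.
have suv s : 0 <= s <= t -> `|s *: u + t *: v| <= t * (`|u| + `|v|).
  by move=> st; rewrite mulrDr -tv (le_trans (ler_normD _ _))// lerD2r su.
have near1 s : 0 <= s <= t -> `|s *: u| < r.
  move=> st; apply: le_lt_trans (su s st) _; apply: le_lt_trans tM.
  by rewrite ler_pM2l// /M; lra.
have near2 s : 0 <= s <= t -> `|s *: u + t *: v| < r.
  move=> st; apply: le_lt_trans (suv s st) _; apply: le_lt_trans tM.
  by rewrite ler_pM2l// /M; lra.
pose phi s := f (s *: u + (t *: v + q)) - f (s *: u + q).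
have dphi s : 0 <= s <= t ->
    is_derive s 1 phi (g (s *: u + (t *: v + q)) - g (s *: u + q)).
  move=> st; apply: is_deriveB; apply: is_derive_line.
    by rewrite addrA; have [] := hr _ (near2 s st).
  by have [] := hr _ (near1 s st).
have cphi : {within `[0, t], continuous phi}.
  apply: derivable_within_continuous => s; rewrite in_itv /= => st.
  by have [] := dphi s st.
have dphi' s : s \in `]0, t[%R ->
    is_derive s 1 phi (g (s *: u + (t *: v + q)) - g (s *: u + q)).
  by rewrite in_itv /= => /andP[s0 st]; apply: dphi; rewrite !ltW.
have [c] := MVT t0 dphi' cphi.
rewrite in_itv /= => /andP[c0 ct]; have {c0 ct}ct : 0 <= c <= t by rewrite !ltW.
rewrite /phi !scale0r !add0r subr0 => ->.
have [g1 _] := hr _ (near1 c ct); have [g2 _] := hr _ (near2 c ct).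
have Lv : 'd g q (c *: u + t *: v) = 'd g q (c *: u) + t * 'D_v g q.
  by rewrite linearD [in X in _ + X = _]linearZ (deriveE _ gd).
rewrite Lv -(addrA (c *: u)) in g2.
(* Both values of [g] are compared with its linearization at [q]: the terms in c u cancel, and t
   times the derivative along [v] remains. *)
have -> : (g (c *: u + (t *: v + q)) - g (c *: u + q)) * t - t ^+ 2 * 'D_v g q =
  t * ((g (c *: u + (t *: v + q)) - g q - ('d g q (c *: u) + t * 'D_v g q))
     - (g (c *: u + q) - g q - 'd g q (c *: u))).
  by ring.
rewrite normrM gtr0_norm// expr2 mulrCA ler_pM2l//.
apply: le_trans (ler_normB _ _) _; apply: le_trans (lerD g2 g1) _.
rewrite -mulrDr -mulrA ler_pM2l// ler_pdivrMl// mulrC.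
apply: le_trans (lerD (suv c ct) (su c ct)) _.
by rewrite -mulrDr ler_pM2l// /M; lra.
Unshelve. all: by end_near.
Qed.

(** The second difference of [f] is symmetric in [u] and [v]. Divided by t^2 it is close to either
    mixed derivative, so these differ by at most any e > 0. *)
Lemma derive_swap f g h q u v :
  (\forall x \near q, is_derive x u f (g x)) ->
  (\forall x \near q, is_derive x v f (h x)) ->
  differentiable g q -> differentiable h q ->
  'D_v g q = 'D_u h q.
Proof.
move=> fu fv dg dh; apply/eqP; rewrite -subr_eq0 -normr_le0.
apply/ler_addgt0Pl => e e0; rewrite addr0.
have e20 : 0 < e / 2 by rewrite divr_gt0.
have h1 := second_difference v fu dg e20.
have h2 := second_difference u fv dh e20.
have [t [[/= t0 g1] g2]] :=
  filter_ex (filterI (filterI (nbhs_right_gt 0) h1) h2).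
have t2 : 0 < t ^+ 2 by rewrite exprn_gt0.
rewrite -(ler_pM2l t2) -[X in X * `|_|](gtr0_norm t2) -normrM.
(* Reordering the sum makes the far corner of the parallelogram the same term in both estimates. *)
move: g1 g2; rewrite addrCA.
set F := f (t *: v + _); set A := f (t *: u + _); set B := f (t *: v + _).
move: (f q) ('D_v g q) ('D_u h q) => C x y g1 g2.
have -> : t ^+ 2 * (x - y) =
    (F - B - (A - C) - t ^+ 2 * y) - (F - A - (B - C) - t ^+ 2 * x).
  by ring.
apply: le_trans (ler_normB _ _) _; apply: le_trans (lerD g2 g1) _; lra.
Qed.

End Schwarz.

(** * Differentiation of vector-valued maps *)

Section DeriveRow.
Context {R : realType} {V : normedModType R}.

Lemma is_derive_coord n (F : V -> 'rV[R]_n) x v k : derivable F x v ->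
  is_derive x v (fun y => F y 0 k) ('D_v F x 0 k).
Proof.
move=> dF; split; first exact: (derivable_mxP _ _ _).1 dF 0 k.
by rewrite derive_mx// mxE.
Qed.

Lemma derive_mink (F H : V -> 'rV[R]_4) x v :
  derivable F x v -> derivable H x v ->
  'D_v (fun y => mink (F y) (H y)) x =
  mink ('D_v F x) (H x) + mink (F x) ('D_v H x).
Proof.
move=> dF dH.
have dk k := is_deriveM (is_derive_coord k dF) (is_derive_coord k dH).
have := is_deriveD
  (is_deriveD (is_deriveD (is_deriveN (dk 0)) (dk 1)) (dk 2)) (dk 3).
move=> [_ E]; rewrite [LHS]E /mink /GRing.scale /=.
move: (F x) (H x) ('D_v F x) ('D_v H x) => y z y' z'; ring.
Qed.

Lemma derive_row_swap n (F : V -> 'rV[R]_n) q u v :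
  (\forall x \near q, differentiable F x) ->
  differentiable ('D_u F) q -> differentiable ('D_v F) q ->
  'D_v ('D_u F) q = 'D_u ('D_v F) q.
Proof.
move=> dF du dv; apply/rowP => k.
have dk w : differentiable ('D_w F) q ->
    differentiable (fun x => 'D_w F x 0 k) q.
  by move=> dw; exact: (differentiable_comp dw (differentiable_coord _ _ _)).
have Fk w : \forall x \near q, is_derive x w (fun y => F y 0 k) ('D_w F x 0 k).
  by apply: filterS dF => x dx; apply: is_derive_coord; exact: diff_derivable.
have := derive_swap (Fk u) (Fk v) (dk u du) (dk v dv).
by rewrite !(derive_mx, mxE)//; apply: diff_derivable.
Qed.

End DeriveRow.

(** * Isotropy of N_z in a conformal chart, and the theorem *)

(** The null and normal conditions on [f] are assumed near [q] because they get differentiated; the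
    frame and the mean curvature enter through their values at [q], so no smooth frame has to be
    built. *)
Lemma isotropic_of_normal (R : realType) (X f : 'rV[R]_2 -> 'rV[R]_4) q
    l a b o k r :
  0 < l -> first_form X q = l%:M ->
  (\forall x \near q, differentiable X x) ->
  (forall v, differentiable ('D_v X) q) ->
  differentiable f q ->
  (\forall x \near q, mink (f x) (f x) = 0 /\
    forall i, mink (f x) (partial i X x) = 0) ->
  normal_frame X q o a b -> k != 0 -> f q = k *: (a + b) ->
  mean_curvature X q = r *: (a + b) ->
  mink (wirtinger f q) (wirtinger f q) = 0.
Proof.
move=> l0 e dX d2X df fX [an bn [aa ab bb b0] _] k0 fq Hq.
have df' v : derivable f q v by exact: diff_derivable.
have fn i : mink (f q) (partial i X q) = 0.
  by have [_] := nbhs_singleton fX.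
have Df i : mink (partial i f q) (f q) = 0.
  have := derive_mink (df' (delta_mx 0 i)) (df' (delta_mx 0 i)).
  (* The product vanishes near [q], so its derivative is that of the constant 0. *)
  rewrite (near_eq_derive (g := cst 0)); last by apply: filterS fX => x [].
  rewrite derive_cst minkC => /esym/eqP.
  by rewrite (minkC (f q)) -/(partial i f q) -mulr2n mulrn_eq0 => /eqP.
have DX i j : mink (partial i f q) (partial j X q) =
    - mink (f q) (partial i (partial j X) q).
  have := derive_mink (df' (delta_mx 0 i))
    (diff_derivable (v := delta_mx 0 i) (d2X (delta_mx 0 j))).
  rewrite (near_eq_derive (g := cst 0)); last first.
    by apply: filterS fX => x [_]; apply.
  by rewrite derive_cst => /esym/eqP; rewrite addr_eq0 => /eqP.
have H0 : mink (f q) (partial 0 (partial 0 X) q) +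
          mink (f q) (partial 1 (partial 1 X) q) = 0.
  have := mean_curvature_conformal e (lt0r_neq0 l0).
  move=> /(_ (f q)) -/(_ (fun i => etrans (minkC _ _) (fn i))).
  (* The mean curvature vector and [f q] are both multiples of the null vector [a + b]. *)
  rewrite Hq (_ : mink _ _ = 0); last first.
    by rewrite fq minkZl minkZr !minkDl !minkDr aa bb (minkC b) ab; ring.
  move=> /esym/eqP; rewrite mulf_eq0 invr_eq0 mulf_eq0 pnatr_eq0 /=.
  rewrite (gt_eqF l0) /=.
  move=> /eqP; move: (partial 0 _ q) (partial 1 _ q) (f q) => y z w.
  by rewrite !(minkC w).
have sym : mink (f q) (partial 0 (partial 1 X) q) =
           mink (f q) (partial 1 (partial 0 X) q).
  have E : partial 0 (partial 1 X) q = partial 1 (partial 0 X) q :=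
    derive_row_swap dX (d2X (delta_mx 0 1)) (d2X (delta_mx 0 0)).
  by rewrite E.
have e00 : mink (partial 0 X q) (partial 0 X q) = l.
  by have /matrixP/(_ 0 0) := e; rewrite !mxE eqxx mulr1n.
have e11 : mink (partial 1 X q) (partial 1 X q) = l.
  by have /matrixP/(_ 1 1) := e; rewrite !mxE eqxx mulr1n.
have e01 : mink (partial 0 X q) (partial 1 X q) = 0.
  by have /matrixP/(_ 0 1) := e; rewrite !mxE mulr0n.
rewrite fq in Df.
have [eq_norm orth] := frame_isotropic (lt0r_neq0 l0) e00 e01 e11
  (an 0) (an 1) (bn 0) (bn 1) aa ab bb k0 (Df 0) (Df 1)
  (DX 0 0) (DX 0 1) (DX 1 0) (DX 1 1) H0 sym.
exact: mink_wirtinger eq_norm orth.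
Qed.

Theorem lemma2 (R : realType) (S : surface R)
    (psi : points S -> matrix R 1 4) (o : bool)
    (G : points S -> option (complex R)) :
  spacelike_surface psi ->
  marginally_trapped psi ->
  adapted_orientation psi o ->
  hyperbolic_gauss_map psi o G ->
  conformal psi G.
Proof.
move=> [[smooth_psi _] _] _ adapted gauss c W N [ac conf] Wo NG dN p cp Wp.
set X := psi \o param c; set q := Defs.coord c p.
have imT : Defs.coord c @` (dom c `&` setT) = cod c by rewrite setIT.
have [dX d2X] : (forall x, cod c x -> differentiable X x) /\
    (forall v x, cod c x -> differentiable ('D_v X) x).
  have := smooth_psi c ac 2%N; rewrite imT => -[h1 h2]; split=> // v.
  by have [] := h2 v.
have cq : cod c q by exists p.
have near_cod : \forall x \near q, cod c x.
  by apply: open_nbhs_nbhs; split => //; exact: cod_open.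
have near_W : \forall x \near q, W (param c x).
  have := param_continuous (c := c).
  rewrite (continuous_open_subspace _ (cod_open (c := c))).
  move=> /(_ q); rewrite inE => /(_ cq); apply.
  rewrite /q paramK//; apply: open_nbhs_nbhs; split => //.
(* Frame and factor are chosen separately at each point, with no regularity in [x]: only [N] itself
   is differentiated. *)
have lift x : cod c x -> W (param c x) -> exists a b k,
    [/\ normal_frame X x o a b, k != 0, N (param c x) = k *: (a + b)
      & exists r, mean_curvature X x = r *: (a + b)].
  move=> [p' cp' <-]; rewrite paramK// => Wp'.
  have [l l0 fl] := conf (Defs.coord c p') (ex_intro2 _ _ p' cp' erefl).
  have [a [b ab]] := normal_frame_exists o l0 fl.
  have [k k0 Nk] := null_class_colinear (gauss c p' a b ac cp' ab) (NG p' Wp').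
  by exists a, b, k; split => //; exact: adapted c p' a b ac cp' ab.
have [l l0 fl] := conf q cq.
have [a [b [k [ab k0 Nk [r Hr]]]]] := lift q cq (nbhs_singleton near_W).
apply: (isotropic_of_normal l0 fl _ _ _ _ ab k0 Nk Hr).
- exact: filterS near_cod.
- by move=> v; exact: d2X.
- exact: dN.
apply: filterS2 near_cod near_W => x cx Wx.
have [a' [b' [k' [[an bn [aa ab' bb _] _] _ Nk' _]]]] := lift x cx Wx.
rewrite /= Nk'; split.
  by rewrite minkZl minkZr !minkDl !minkDr aa bb (minkC b') ab'; ring.
by move=> i; rewrite minkZl minkDl an bn addr0 mulr0.
Qed.
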